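(* Let $\mathcal T,\mathcal A,\mathcal B,\mathcal C$ be 4-PI operators as below, and assume the auxiliary PIE and the dual auxiliary PIE are well-posed. Suppose there exist $\gamma>0$ and a 4-PI operator $\mathcal Q:\mathbb{R}L_2^{m,n}[a,b]\to\mathbb{R}L_2^{m,n}[a,b]$ with $\mathcal Q\succeq0$ such that one of the following holds: (i) $\mathcal B^*\mathcal Q\mathcal B\preceq I$, $\ \mathcal A^*\mathcal Q\mathcal T+\mathcal T^*\mathcal Q\mathcal A\preceq0$, $\ \frac{1}{\gamma^2}\mathcal C^*\mathcal C\preceq\mathcal T^*\mathcal Q\mathcal T$; (ii) $\mathcal C\mathcal Q\mathcal C^*\preceq I$, $\ \mathcal A\mathcal Q\mathcal T^*+\mathcal T\mathcal Q\mathcal A^*\preceq0$, $\ \frac{1}{\gamma^2}\mathcal B\mathcal B^*\preceq\mathcal T\mathcal Q\mathcal T^*$. Then $\|G(\mathcal T,\mathcal A,\mathcal B,\mathcal C)\|_{ip}\le\gamma$.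
   Context: Notation: $\mathbb{R}L_2^{m,n}[a,b]:=\mathbb{R}^m\times L_2^n[a,b]$, the Hilbert space with inner product $\langle (x,\mathbf x),(y,\mathbf y)\rangle=x^\top y+\int_a^b \mathbf x(s)^\top\mathbf y(s)\,ds$. Finite-dimensional spaces $\mathbb{R}^k$ carry the Euclidean inner product and norm, and are identified with $\mathbb{R}L_2^{k,0}$. $\mathcal P^*$ denotes the Hilbert adjoint. For a bounded operator $\mathcal P$ on a Hilbert space $H$, $\mathcal P\succeq0$ means $\mathcal P$ is self-adjoint and $\langle h,\mathcal Ph\rangle\ge0$ for all $h\in H$; $\mathcal P\preceq\mathcal R$ means $\mathcal R-\mathcal P\succeq0$; $I$ is the identity. A 4-PI operator $\mathcal P:\mathbb{R}L_2^{m_1,n_1}[a,b]\to\mathbb{R}L_2^{m_2,n_2}[a,b]$ is one of the form $$\mathcal P\begin{bmatrix}x\\ \mathbf x\end{bmatrix}(s)=\begin{bmatrix}Px+\int_a^b Q_1(\theta)\mathbf x(\theta)\,d\theta\\ Q_2(s)x+R_0(s)\mathbf x(s)+\int_a^s R_1(s,\theta)\mathbf x(\theta)\,d\theta+\int_s^b R_2(s,\theta)\mathbf x(\theta)\,d\theta\end{bmatrix},$$ with $P$ a real matrix and $Q_1,Q_2,R_0,R_1,R_2$ real matrix-valued polynomials. Here $\mathcal T,\mathcal A:\mathbb{R}L_2^{m,n}[a,b]\to\mathbb{R}L_2^{m,n}[a,b]$, $\mathcal B:\mathbb{R}^{n_w}\to\mathbb{R}L_2^{m,n}[a,b]$, $\mathcal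 C:\mathbb{R}L_2^{m,n}[a,b]\to\mathbb{R}^{n_z}$ are 4-PI operators. Auxiliary PIE: given $v\in\mathbb{R}^{n_w}$, a solution is a continuously differentiable $\mathbf x:[0,\infty)\to\mathbb{R}L_2^{m,n}[a,b]$ with $\frac{d}{dt}(\mathcal T\mathbf x(t))=\mathcal A\mathbf x(t)$ for all $t\ge0$, $\mathcal T\mathbf x(0)=\mathcal Bv$, and output $z(t)=\mathcal C\mathbf x(t)$; it is well-posed if for each $v$ a unique solution exists. Dual auxiliary PIE: given $\bar v\in\mathbb{R}^{n_z}$, a solution is a continuously differentiable $\bar{\mathbf x}:[0,\infty)\to\mathbb{R}L_2^{m,n}[a,b]$ with $\frac{d}{dt}(\mathcal T^*\bar{\mathbf x}(t))=\mathcal A^*\bar{\mathbf x}(t)$, $\mathcal T^*\bar{\mathbf x}(0)=\mathcal C^*\bar v$, output $\bar z(t)=\mathcal B^*\bar{\mathbf x}(t)$; well-posed analogously. Impulse-to-peak norm: $\|G(\mathcal T,\mathcal A,\mathcal B,\mathcal C)\|_{ip}:=\sup\{\sup_{t\ge0}\|z(t)\|:\|v\|=1,\ z\text{ output of a solution of the auxiliary PIE with data }v\}$. *)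

(* Defs.v *)
From HB Require Import structures.
From mathcomp Require Import all_boot all_order all_algebra.
From mathcomp Require Import all_classical all_reals all_analysis.
Set Implicit Arguments. Unset Strict Implicit. Unset Printing Implicit Defensive.
Import Order.TTheory GRing.Theory Num.Theory.
Local Open Scope classical_set_scope.
Local Open Scope ring_scope.

Section PIE.
Variable R : realType.

(** Carrier of RL_2^{k,l}[a,b]: a vector in R^k and a function s |-> R^l
    (only its values on [a,b] matter; elements are required to be L2 via [inL2]).
    R^k is identified with RL_2^{k,0}. *)
Definition H (k l : nat) := ('cV[R]_k * (R -> 'cV[R]_l))%type.

Definition hadd k l (h g : H k l) : H k l := (h.1 + g.1, fun s => h.2 s + g.2 s).
Definition hscale k l (c : R) (h : H k l) : H k l := (c *: h.1, fun s => c *: h.2 s).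
Definition hsub k l (h g : H k l) : H k l := hadd h (hscale (-1) g).
Definition hzero k l : H k l := (0, fun _ => 0).
Definition vecH k (v : 'cV[R]_k) : H k 0 := (v, fun _ => 0).

Definition dotv k (x y : 'cV[R]_k) : R := (x^T *m y) 0 0.
Definition eucnorm k (x : 'cV[R]_k) : R := Num.sqrt (dotv x x).

Definition vint l (D : set R) (f : R -> 'cV[R]_l) : 'cV[R]_l :=
  \col_i Rintegral lebesgue_measure D (fun s => f s i 0).

Definition inL2 (a b : R) k l (h : H k l) : Prop :=
  forall i : 'I_l,
    measurable_fun `[a, b] (fun s => h.2 s i 0) /\
    lebesgue_measure.-integrable `[a, b] (fun s => ((h.2 s i 0) ^+ 2)%:E).

Definition ip (a b : R) k l (h g : H k l) : R :=
  dotv h.1 g.1 + Rintegral lebesgue_measure `[a, b] (fun s => dotv (h.2 s) (g.2 s)).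
Definition nrm (a b : R) k l (h : H k l) : R := Num.sqrt (ip a b h h).

(** 4-PI operators RL_2^{m1,n1} -> RL_2^{m2,n2}; bivariate polynomials R1(s,θ), R2(s,θ)
    are represented in {poly {poly R}}: outer variable θ, inner variable s. *)
Record PIop (m1 n1 m2 n2 : nat) := mkPIop {
  PI_P  : 'M[R]_(m2, m1);
  PI_Q1 : 'M[{poly R}]_(m2, n1);
  PI_Q2 : 'M[{poly R}]_(n2, m1);
  PI_R0 : 'M[{poly R}]_(n2, n1);
  PI_R1 : 'M[{poly {poly R}}]_(n2, n1);
  PI_R2 : 'M[{poly {poly R}}]_(n2, n1) }.

Definition ev1 p q (M : 'M[{poly R}]_(p, q)) (s : R) : 'M[R]_(p, q) :=
  map_mx (fun e => e.[s]) M.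
Definition ev2 p q (M : 'M[{poly {poly R}}]_(p, q)) (s th : R) : 'M[R]_(p, q) :=
  map_mx (fun e => (e.[th%:P]).[s]) M.

Definition PIapply (a b : R) m1 n1 m2 n2 (O : PIop m1 n1 m2 n2) (h : H m1 n1)
  : H m2 n2 :=
  (PI_P O *m h.1 + vint `[a, b] (fun th => ev1 (PI_Q1 O) th *m h.2 th),
   fun s => ev1 (PI_Q2 O) s *m h.1 + ev1 (PI_R0 O) s *m h.2 s
            + vint `[a, s] (fun th => ev2 (PI_R1 O) s th *m h.2 th)
            + vint `[s, b] (fun th => ev2 (PI_R2 O) s th *m h.2 th)).

Definition is_adjoint (a b : R) k1 l1 k2 l2 (F : H k1 l1 -> H k2 l2) (G : H k2 l2 -> H k1 l1)
  : Prop :=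
  (forall g, inL2 a b g -> inL2 a b (G g)) /\
  (forall h g, inL2 a b h -> inL2 a b g -> ip a b (F h) g = ip a b h (G g)).

Definition psd (a b : R) k l (F : H k l -> H k l) : Prop :=
  (forall h g, inL2 a b h -> inL2 a b g -> ip a b (F h) g = ip a b h (F g)) /\
  (forall h, inL2 a b h -> 0 <= ip a b h (F h)).
Definition ople (a b : R) k l (F G : H k l -> H k l) : Prop :=
  psd a b (fun h => hsub (G h) (F h)).

Definition has_deriv_at (a b : R) k l (y : R -> H k l) (y' : H k l) (t : R) : Prop :=
  forall e, 0 < e -> exists2 d, 0 < d & forall h, h != 0 -> `|h| < d -> 0 <= t + h ->
    nrm a b (hsub (hscale h^-1 (hsub (y (t + h)) (y t))) y') <= e.

Definition cont_on_nonneg (a b : R) k l (y : R -> H k l) : Prop :=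
  forall t, 0 <= t -> forall e, 0 < e -> exists2 d, 0 < d & forall s, 0 <= s ->
    `|s - t| < d -> nrm a b (hsub (y s) (y t)) < e.

Definition is_solution (a b : R) m n k (T A : H m n -> H m n) (B : H k 0 -> H m n)
    (v : 'cV[R]_k) (x : R -> H m n) : Prop :=
  (forall t, 0 <= t -> inL2 a b (x t)) /\
  (exists x' : R -> H m n,
     (forall t, 0 <= t -> inL2 a b (x' t)) /\
     (forall t, 0 <= t -> has_deriv_at a b x (x' t) t) /\
     cont_on_nonneg a b x') /\
  (forall t, 0 <= t -> has_deriv_at a b (fun s => T (x s)) (A (x t)) t) /\
  nrm a b (hsub (T (x 0)) (B (vecH v))) = 0.

Definition well_posed (a b : R) m n k (T A : H m n -> H m n) (B : H k 0 -> H m n) : Prop :=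
  forall v : 'cV[R]_k,
    (exists x, is_solution a b T A B v x) /\
    (forall x y, is_solution a b T A B v x -> is_solution a b T A B v y ->
       forall t, 0 <= t -> nrm a b (hsub (x t) (y t)) = 0).

Definition ip_norm (a b : R) m n k p (T A : H m n -> H m n) (B : H k 0 -> H m n)
    (C : H m n -> H p 0) : \bar R :=
  ereal_sup [set (eucnorm (C (x t)).1)%:E | x in
     [set x | exists v : 'cV[R]_k, eucnorm v = 1 /\ is_solution a b T A B v x]
     & t in [set t : R | 0 <= t]].

End PIE.

(* Main.v *)
(** Under (i), the storage function V(t) = <T x(t), Q T x(t)> is nonincreasing
    along solutions, V(0) <= |v|^2, and |C x(t)|^2 <= gamma^2 V(t).

    Condition (ii) is (i) for the dual system, so the dual output obeys the same
    bound. To transfer it, note that s |-> <T x(t - s), y(s)> is constant on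
    [0, t] for a primal solution x and a dual solution y, hence
    <C x(t), w> = <v, B^* y(t)> when y starts from C^* w; take w = C x(t).

    Differentiating V requires Q to be bounded; this follows from pointwise
    estimates |(Q h)(s)| <= K (|h| + |h(s)|). *)
Require Import Defs.
From HB Require Import structures.
From mathcomp Require Import all_boot all_order all_algebra.
From mathcomp Require Import all_classical all_reals all_analysis.
From mathcomp Require Import measurable_realfun ring lra.
Import Order.TTheory GRing.Theory Num.Theory.
Local Open Scope ring_scope.

(** Elements of [H] are functions, not classes modulo null sets, and their values outside the
    interval are arbitrary. So [nrm] is only a seminorm, and the initial conditions hold only up to
    [nrm] zero; such identities are used inside [ip], where Cauchy-Schwarz makes them exact.

    The adjoints are arbitrary maps characterised by [is_adjoint] on square-integrable elements,
    with no 4-PI formula. The evolution lemmas are therefore stated for abstract maps that preserve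
    [inL2], so that the dual system is an instance of the same statements.

    No derivative of a scalar energy is formed. Each difference quotient is split into a term whose
    sign is known, or that cancels by adjointness, and errors bounded by a constant times [e1]; the
    tolerance [e1 = e / L] is chosen so that these errors add up to at most [e].

    For a 4-PI operator, the multiplier [R0] accounts for the local term in the pointwise estimate,
    while every integral term is controlled by the global norm through Cauchy-Schwarz on a bounded
    interval. *)

Section Preliminaries.
Set Implicit Arguments.
Unset Strict Implicit.
Context {R : realType}.

(** Common core of the two Cauchy-Schwarz inequalities below. For [q > 0] the quadratic is tested at
    its minimiser [c / q]. *)
Lemma discriminant_le (p c q : R) : 0 <= p -> 0 <= q ->
  (forall t : R, 0 <= p - 2 * t * c + t ^+ 2 * q) -> c ^+ 2 <= p * q.
Proof.
move=> p0; rewrite le_eqVlt => /orP[/eqP <- H|q0 H].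
  have [->|c0] := eqVneq c 0; first by rewrite expr0n mulr0.
  (* For [q = 0] the expression is affine in [t], and this point gives it the value [-1]. *)
  by have := H ((p + 1) / (2 * c)); rewrite (_ : _ + _ = - 1); [lra | field].
have := H (c / q); rewrite (_ : _ + _ = (p * q - c ^+ 2) / q); last first.
  by field; rewrite gt_eqF.
by rewrite pmulr_lge0 ?invr_gt0// subr_ge0.
Qed.

(* Only the upper bound on the difference quotients is needed: the supremum of
   the points where the inequality holds is reached from the left and cannot be
   smaller than [t]. *)
Lemma nonincreasing_of_quotients (f : R -> R) (t : R) : 0 <= t ->
  (forall s, 0 <= s <= t -> forall e, 0 < e -> exists2 d, 0 < d &
     forall h, h != 0 -> `|h| < d -> 0 <= s + h <= t ->
       h^-1 * (f (s + h) - f s) <= e) ->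
  f t <= f 0.
Proof.
move=> t0 H.
suff E e : 0 < e -> f t <= f 0 + e * t.
  apply/ler_addgt0Pr => e e0.
  (* The slack is divided by [t + 1] because [t] may vanish. *)
  have t1 : 0 < t + 1 by lra.
  apply: (le_trans (E (e / (t + 1)) _)); first by rewrite divr_gt0.
  by rewrite lerD2l mulrAC ler_pdivrMr// ler_pM2l//; lra.
move=> e0.
pose S : set R := [set s | 0 <= s <= t /\ f s <= f 0 + e * s]%classic.
have S0 : S 0 by split; rewrite ?lexx// mulr0 addr0.
have Sub : has_sup S.
  by split; [exists 0 | exists t => s [/andP[]]].
pose c := sup S.
have c0 : 0 <= c by apply: sup_upper_bound.
have ct : c <= t by apply: ge_sup; [exists 0 | move=> s [/andP[]]].
have [|d d0 Hd] := H c _ e e0; first by rewrite c0.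
have Sc : S c.
  split; first by rewrite c0.
  have [s Ss cs] := sup_adherent d0 Sub.
  have sc : s <= c by apply: sup_upper_bound.
  case: Ss => /andP[s0 st] fs.
  have [<-//|nsc] := eqVneq s c.
  have slc : s < c by rewrite lt_neqAle nsc.
  have h0 : s - c < 0 by lra.
  have := Hd (s - c); rewrite (_ : c + (s - c) = s); last by ring.
  rewrite s0 st lt_eqF// ltr0_norm// => /(_ isT) hd.
  have {}hd : (s - c)^-1 * (f s - f c) <= e.
    by apply: hd => //; move: cs; rewrite -/c; lra.
  suff : f c - f s <= e * (c - s) by lra.
  rewrite -ler_pdivrMr; last by lra.
  apply: le_trans hd; rewrite le_eqVlt; apply/orP; left; apply/eqP.
  by field; rewrite lt_eqF//= subr_eq0 eq_sym.
suff -> : t = c by case: Sc.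
apply/eqP; rewrite eq_le ct andbT leNgt; apply/negP => clt.
pose h := Num.min (d / 2) (t - c).
have h0 : 0 < h by rewrite lt_min; apply/andP; split; lra.
have hd : h < d by rewrite gt_min; apply/orP; left; lra.
have ht : h <= t - c by rewrite ge_min lexx orbT.
have := Hd h; rewrite gt_eqF// gtr0_norm// => /(_ isT hd) Hh.
suff : c + h <= c by lra.
apply: (sup_upper_bound Sub); split; first by apply/andP; split; lra.
have : h^-1 * (f (c + h) - f c) <= e by apply: Hh; apply/andP; split; lra.
by rewrite mulrC ler_pdivrMr//; case: Sc => _; lra.
Qed.

(** Adding the constants instead of taking their maximum also covers an empty index type. With
    general [S], [P] and [w], the lemma applies to pairs of points as well as to pairs of an element
    and a point. *)
Lemma finite_uniform_bound (I : finType) (S : Type) (P : S -> Prop)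
    (F : I -> S -> R) (w : S -> R) :
  (forall s, P s -> 0 <= w s) ->
  (forall i, exists2 M, 0 <= M & forall s, P s -> F i s <= M * w s) ->
  exists2 M, 0 <= M & forall i s, P s -> F i s <= M * w s.
Proof.
move=> w0 H; have /boolp.choice[M HM] : forall i, exists M, 0 <= M /\
    forall s, P s -> F i s <= M * w s.
  by move=> i; have [M M0 HM] := H i; exists M.
exists (\sum_i M i); first by apply: sumr_ge0 => i _; have [] := HM i.
move=> i s Ps; have [_ /(_ s Ps) /le_trans] := HM i; apply.
apply: ler_wpM2r; first exact: w0.
by rewrite (bigD1 i)//= lerDl sumr_ge0// => j _; have [] := HM j.
Qed.

End Preliminaries.

(** * Scalar square-integrable functions on a bounded interval *)

Section SquareIntegrable.
Set Implicit Arguments.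
Unset Strict Implicit.
Context {R : realType} {a b : R}.
Local Notation mu := (@lebesgue_measure R).
Local Notation D := (`[a, b]%classic : set R).
Implicit Types f g : R -> R.

(** [inL2] unfolds to this property of each coordinate, so the scalar lemmas apply to it
    directly. *)
Definition l2 f := measurable_fun D f /\ mu.-integrable D (fun s => ((f s) ^+ 2)%:E).

Let mD : measurable D. Proof. exact: measurable_itv. Qed.

Lemma l2M f g : l2 f -> l2 g -> mu.-integrable D (EFin \o (fun s => f s * g s)).
Proof.
move=> [mf f2] [mg g2].
apply: (@le_integrable _ _ _ mu D mD _
  (fun s => ((f s) ^+ 2)%:E + ((g s) ^+ 2)%:E)%E).
- by apply/measurable_EFinP; exact: measurable_funM.
- move=> s _ /=; rewrite lee_fin [leRHS]ger0_norm; last first.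
    by rewrite addr_ge0 ?sqr_ge0.
  by have := sqr_ge0 (f s - g s); have := sqr_ge0 (f s + g s);
    rewrite ler_norml; nra.
- exact: integrableD.
Qed.

Lemma l2_le f g : measurable_fun D f -> l2 g ->
  (forall s, D s -> `|f s| <= `|g s|) -> l2 f.
Proof.
move=> mf [mg g2] fg; split => //.
apply: (@le_integrable _ _ _ mu D mD _ (fun s => ((g s) ^+ 2)%:E)) => //.
- by apply/measurable_EFinP; exact: measurable_funX.
- move=> s Ds /=; rewrite lee_fin !normrX.
  by rewrite ler_pXn2r ?nnegrE// fg.
Qed.

Lemma l2D f g : l2 f -> l2 g -> l2 (fun s => f s + g s).
Proof.
move=> lf lg; have [mf f2] := lf; have [mg g2] := lg.
split; first exact: measurable_funD.
apply: (@eq_integrable _ _ _ mu D mD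
  (fun s => (f s ^+ 2)%:E + ((f s * g s)%:E + (f s * g s)%:E) + (g s ^+ 2)%:E)%E).
  by move=> s _; rewrite -!EFinD; congr EFin; ring.
by do !apply: integrableD => //; exact: l2M.
Qed.

Lemma l2Z (c : R) f : l2 f -> l2 (fun s => c * f s).
Proof.
move=> [mf f2]; split; first exact: measurable_funM.
apply: (@eq_integrable _ _ _ mu D mD (fun s => (c ^+ 2)%:E * (f s ^+ 2)%:E)%E).
  by move=> s _; rewrite -EFinM exprMn.
exact: integrableZl.
Qed.

Lemma mu_itv_lty : (mu D < +oo)%E.
Proof.
have [ab|ab] := leP a b.
  by rewrite lebesgue_measure_itv /=; case: ifP => _; rewrite ?ltry.
by rewrite set_itv_ge ?measure0// bnd_simp -ltNge.
Qed.

Lemma integrable_cst_itv (c : R) : mu.-integrable D (EFin \o (fun=> c)).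
Proof.
apply: (@measurable_bounded_integrable _ _ _ mu _ D mD mu_itv_lty) => //.
exists `|c|; split; first exact: num_real.
by move=> x cx y _ /=; exact: ltW.
Qed.

Lemma l2_cst (c : R) : l2 (fun=> c).
Proof. by split => //; exact: integrable_cst_itv. Qed.

Lemma l2_norm f : l2 f -> l2 (fun s => `|f s|).
Proof.
move=> lf; apply: (l2_le _ lf); last by move=> s _; rewrite normr_id.
by apply: measurableT_comp => //; case: lf.
Qed.

Lemma l2_integrable f : l2 f -> mu.-integrable D (EFin \o f).
Proof.
move=> lf; have := l2M (l2_cst 1) lf.
by apply: eq_integrable => // s _ /=; rewrite mul1r.
Qed.

Lemma l2_Mbounded g f (M : R) : measurable_fun D g ->
  (forall s, D s -> `|g s| <= M) -> l2 f -> l2 (fun s => g s * f s).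
Proof.
move=> mg gM lf; apply: (l2_le _ (l2Z M lf)).
  by apply: measurable_funM => //; case: lf.
by move=> s /gM gs; rewrite !normrM ler_wpM2r// (le_trans gs)// ler_norm.
Qed.

Lemma fine_mu_itv : a <= b -> fine (mu D) = b - a.
Proof.
rewrite lebesgue_measure_itv /= lte_fin le_eqVlt => /orP[/eqP ->|->//].
by rewrite ltxx subrr.
Qed.

Lemma Rintegral_cst_itv (c : R) : a <= b ->
  Rintegral mu D (fun=> c) = c * (b - a).
Proof. by move=> ab; rewrite Rintegral_cst//; congr (_ * _); exact: fine_mu_itv. Qed.

(** Cauchy-Schwarz against the constant 1: the quadratic passed to [discriminant_le] is the integral
    of [(|f| - t)^2]. *)
Lemma Rintegral_norm_sqr f : a <= b -> l2 f ->
  (Rintegral mu D (fun s => `|f s|)) ^+ 2 <=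
  (b - a) * Rintegral mu D (fun s => f s ^+ 2).
Proof.
move=> ab lf; rewrite mulrC; apply: discriminant_le.
- by apply: Rintegral_ge0 => s _; rewrite sqr_ge0.
- by rewrite subr_ge0.
move=> t.
have i1 := l2_integrable (l2_norm lf).
have i2 : mu.-integrable D (EFin \o (fun s => f s ^+ 2)) by case: lf.
have i3 : mu.-integrable D (EFin \o (fun s => 2 * t * `|f s|)).
  exact: l2_integrable (l2Z _ (l2_norm lf)).
have i4 : mu.-integrable D (EFin \o (fun s => f s ^+ 2 - 2 * t * `|f s|)).
  by apply: integrableB i2 i3.
have -> : Rintegral mu D (fun s => f s ^+ 2) - 2 * t * Rintegral mu D (fun s => `|f s|)
    + t ^+ 2 * (b - a) = Rintegral mu D (fun s => (`|f s| - t) ^+ 2).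
  rewrite -RintegralZl// -Rintegral_cst_itv// -RintegralB// -RintegralD//.
    by apply: eq_Rintegral => s _; rewrite -(real_normK (num_real (f s))); ring.
  exact: integrable_cst_itv.
by apply: Rintegral_ge0 => s _; rewrite sqr_ge0.
Qed.

End SquareIntegrable.
Arguments l2 {R} a b f.

(** * The semi-inner product [ip] and its seminorm [nrm] *)

Section InnerProduct.
Set Implicit Arguments.
Unset Strict Implicit.
Context {R : realType} {a b : R}.
Local Notation mu := (@lebesgue_measure R).
Local Notation D := (`[a, b]%classic : set R).

Let mD : measurable D. Proof. exact: measurable_itv. Qed.

Lemma dotvE k (x y : 'cV[R]_k) : dotv x y = \sum_i x i 0 * y i 0.
Proof. by rewrite /dotv mxE; apply: eq_bigr => i _; rewrite mxE. Qed.

Lemma dotvC k (x y : 'cV[R]_k) : dotv x y = dotv y x.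
Proof. by rewrite !dotvE; apply: eq_bigr => i _; rewrite mulrC. Qed.

Lemma dotvDl k (x y z : 'cV[R]_k) : dotv (x + y) z = dotv x z + dotv y z.
Proof. by rewrite /dotv linearD mulmxDl mxE. Qed.

Lemma dotvZl k (c : R) (x z : 'cV[R]_k) : dotv (c *: x) z = c * dotv x z.
Proof. by rewrite /dotv linearZ -scalemxAl mxE. Qed.

Lemma dotv_ge0 k (x : 'cV[R]_k) : 0 <= dotv x x.
Proof. by rewrite dotvE sumr_ge0// => i _; rewrite -expr2 sqr_ge0. Qed.

Lemma eucnorm_sqr k (x : 'cV[R]_k) : eucnorm x ^+ 2 = dotv x x.
Proof. by rewrite sqr_sqrtr// dotv_ge0. Qed.

Lemma norm_le_eucnorm k (x : 'cV[R]_k) i : `|x i 0| <= eucnorm x.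
Proof.
rewrite -sqrtr_sqr ler_wsqrtr// dotvE (bigD1 i)//= expr2 lerDl sumr_ge0// => j _.
by rewrite -expr2 sqr_ge0.
Qed.

Lemma integrable_dotv k l (h g : H R k l) : inL2 a b h -> inL2 a b g ->
  mu.-integrable D (EFin \o (fun s => dotv (h.2 s) (g.2 s))).
Proof.
move=> Lh Lg.
apply: (@eq_integrable _ _ _ mu D mD
  (fun s => (\sum_i (h.2 s i 0 * g.2 s i 0)%:E)%E)).
  by move=> s _ /=; rewrite dotvE sumEFin.
by apply: integrable_sum => // i _; exact: (l2M (Lh i) (Lg i)).
Qed.

Lemma ipC k l (h g : H R k l) : ip a b h g = ip a b g h.
Proof.
by rewrite /ip dotvC; congr (_ + _); apply: eq_Rintegral => s _; rewrite dotvC.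
Qed.

Lemma inL2_hadd k l (h g : H R k l) :
  inL2 a b h -> inL2 a b g -> inL2 a b (hadd h g).
Proof.
move=> Lh Lg i; have := l2D (Lh i) (Lg i).
by rewrite (_ : (fun s => _ + _) = fun s => (hadd h g).2 s i 0)//;
  apply/funext => s; rewrite !mxE.
Qed.

Lemma inL2_hscale k l (c : R) (h : H R k l) : inL2 a b h -> inL2 a b (hscale c h).
Proof.
move=> Lh i; have := l2Z c (Lh i).
by rewrite (_ : (fun s => _ * _) = fun s => (hscale c h).2 s i 0)//;
  apply/funext => s; rewrite !mxE.
Qed.

Lemma inL2_hsub k l (h g : H R k l) :
  inL2 a b h -> inL2 a b g -> inL2 a b (hsub h g).
Proof. by move=> Lh Lg; apply: inL2_hadd => //; exact: inL2_hscale. Qed.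

Lemma inL2_fin k (h : H R k 0) : inL2 a b h.
Proof. by case. Qed.

Lemma ipDl k l (h g f : H R k l) : inL2 a b h -> inL2 a b g -> inL2 a b f ->
  ip a b (hadd h g) f = ip a b h f + ip a b g f.
Proof.
move=> Lh Lg Lf; rewrite /ip dotvDl addrACA; congr (_ + _).
rewrite -RintegralD//; [|exact: integrable_dotv..].
by apply: eq_Rintegral => s _; rewrite dotvDl.
Qed.

Lemma ipZl k l (c : R) (h f : H R k l) : inL2 a b h -> inL2 a b f ->
  ip a b (hscale c h) f = c * ip a b h f.
Proof.
move=> Lh Lf; rewrite /ip dotvZl mulrDr; congr (_ + _).
rewrite -RintegralZl//; last exact: integrable_dotv.
by apply: eq_Rintegral => s _; rewrite dotvZl.
Qed.

Lemma ipDr k l (f h g : H R k l) : inL2 a b f -> inL2 a b h -> inL2 a b g ->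
  ip a b f (hadd h g) = ip a b f h + ip a b f g.
Proof. by move=> Lf Lh Lg; rewrite ipC ipDl// !(ipC f). Qed.

Lemma ipZr k l (c : R) (f h : H R k l) : inL2 a b f -> inL2 a b h ->
  ip a b f (hscale c h) = c * ip a b f h.
Proof. by move=> Lf Lh; rewrite ipC ipZl// ipC. Qed.

Lemma ipBl k l (h g f : H R k l) : inL2 a b h -> inL2 a b g -> inL2 a b f ->
  ip a b (hsub h g) f = ip a b h f - ip a b g f.
Proof.
by move=> Lh Lg Lf; rewrite ipDl// ?ipZl ?mulN1r//; exact: inL2_hscale.
Qed.

Lemma ipBr k l (f h g : H R k l) : inL2 a b f -> inL2 a b h -> inL2 a b g ->
  ip a b f (hsub h g) = ip a b f h - ip a b f g.
Proof. by move=> Lf Lh Lg; rewrite ipC ipBl// !(ipC f). Qed.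

Lemma ip_ge0 k l (h : H R k l) : 0 <= ip a b h h.
Proof.
by rewrite addr_ge0 ?dotv_ge0// Rintegral_ge0// => s _; exact: dotv_ge0.
Qed.

Lemma nrm_ge0 k l (h : H R k l) : 0 <= nrm a b h.
Proof. exact: sqrtr_ge0. Qed.

Lemma nrm_sqr k l (h : H R k l) : nrm a b h ^+ 2 = ip a b h h.
Proof. by rewrite sqr_sqrtr// ip_ge0. Qed.

Lemma nrm_le k l (h : H R k l) (c : R) : 0 <= c -> ip a b h h <= c ^+ 2 -> nrm a b h <= c.
Proof. by move=> c0 hc; rewrite -(ger0_norm c0) -sqrtr_sqr ler_wsqrtr. Qed.

(** Since [ip] is only semidefinite, the norm of [g] may vanish for nonzero [g]; [discriminant_le]
    includes that case. *)
Lemma cauchy_schwarz k l (h g : H R k l) : inL2 a b h -> inL2 a b g ->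
  `|ip a b h g| <= nrm a b h * nrm a b g.
Proof.
move=> Lh Lg; rewrite -[leRHS]ger0_norm ?mulr_ge0 ?nrm_ge0//.
rewrite -ler_sqr ?nnegrE// !real_normK ?num_real// exprMn !nrm_sqr.
apply: discriminant_le; [exact: ip_ge0..|] => t.
have Lt := inL2_hscale t Lg.
have := ip_ge0 (hsub h (hscale t g)).
rewrite ipBl ?ipBr ?ipZl ?ipZr//; last exact: inL2_hsub.
by rewrite (ipC g h); congr (0 <= _); ring.
Qed.

Lemma nrm_hadd k l (h g : H R k l) : inL2 a b h -> inL2 a b g ->
  nrm a b (hadd h g) <= nrm a b h + nrm a b g.
Proof.
move=> Lh Lg; apply: nrm_le; first by rewrite addr_ge0 ?nrm_ge0.
have Lhg := inL2_hadd Lh Lg.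
rewrite ipDl// !ipDr// (ipC g h) sqrrD !nrm_sqr.
by have := cauchy_schwarz Lh Lg; rewrite ler_norml => /andP[_]; lra.
Qed.

Lemma nrm_hscale k l (c : R) (h : H R k l) : inL2 a b h ->
  nrm a b (hscale c h) = `|c| * nrm a b h.
Proof.
move=> Lh; have Lc := inL2_hscale c Lh.
by rewrite /nrm ipZl// ipZr// mulrA -expr2 sqrtrM ?sqr_ge0// sqrtr_sqr.
Qed.

(** Serves to substitute an initial condition, known up to seminorm zero, into an inner product. *)
Lemma ip_nrm_hsub0 k l (h g f : H R k l) :
  inL2 a b h -> inL2 a b g -> inL2 a b f -> nrm a b (hsub h g) = 0 ->
  ip a b h f = ip a b g f.
Proof.
move=> Lh Lg Lf E; apply/eqP; rewrite -subr_eq0 -ipBl// -normr_le0.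
by apply: le_trans (cauchy_schwarz (inL2_hsub Lh Lg) Lf) _; rewrite E mul0r.
Qed.

Lemma ip_fin k (h g : H R k 0) : ip a b h g = dotv h.1 g.1.
Proof.
rewrite /ip (@eq_Rintegral _ _ _ _ _ (fun=> 0)).
  by rewrite Rintegral_cst// mul0r addr0.
by move=> s _; rewrite dotvE big_ord0.
Qed.

Lemma nrm_fin k (h : H R k 0) : nrm a b h = eucnorm h.1.
Proof. by rewrite /nrm ip_fin. Qed.

End InnerProduct.

(** * Square integrability and boundedness of 4-PI images *)

Section PIOperators.
Set Implicit Arguments.
Unset Strict Implicit.
Context {R : realType} {a b : R}.
Hypothesis ab : a <= b.
Local Notation mu := (@lebesgue_measure R).
Local Notation D := (`[a, b]%classic : set R).

Lemma Rintegral_sum (I : finType) (J : set R) (F : I -> R -> R) :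
  measurable J -> (forall i, mu.-integrable J (EFin \o F i)) ->
  Rintegral mu J (fun s => \sum_i F i s) = \sum_i Rintegral mu J (F i).
Proof.
move=> mJ FJ.
(* The induction carries integrability of the partial sums, which additivity of the integral
   requires. *)
suff [] : mu.-integrable J (EFin \o (fun s => \sum_i F i s)) /\
  Rintegral mu J (fun s => \sum_i F i s) = \sum_i Rintegral mu J (F i) by [].
elim: (index_enum I) => [|i r [IH1 IH2]].
  have -> : (fun s => \sum_(i <- [::]) F i s) = fun=> 0.
    by apply/funext => s; rewrite big_nil.
  by split; [exact: integrable0 | rewrite big_nil Rintegral_cst// mul0r].
have -> : (fun s => \sum_(j <- i :: r) F j s) = fun s => F i s + \sum_(j <- r) F j s.
  by apply/funext => s; rewrite big_cons.
by rewrite big_cons RintegralD// IH2; split=> //; apply: integrableD (FJ i) IH1.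
Qed.

Lemma le_Rintegral_subset (J : set R) (f : R -> R) : measurable J ->
  (J `<=` D)%classic -> mu.-integrable D (EFin \o f) ->
  (forall s, D s -> 0 <= f s) -> Rintegral mu J f <= Rintegral mu D f.
Proof.
move=> mJ JD fD f0.
have fJ : mu.-integrable J (EFin \o f) by apply: integrableS fD.
apply: fine_le; [exact: integrable_fin_num..|].
apply: ge0_subset_integral => //; first by case/integrableP: fD.
Qed.

Lemma coord_le_nrm m n (h : H R m n) j : `|h.1 j 0| <= nrm a b h.
Proof.
apply: le_trans (norm_le_eucnorm _ _) _; apply: ler_wsqrtr.
by rewrite lerDl Rintegral_ge0// => s _; exact: dotv_ge0.
Qed.

Lemma Rintegral_norm_le_nrm m n (h : H R m n) j : inL2 a b h ->
  Rintegral mu D (fun s => `|h.2 s j 0|) <= Num.sqrt (b - a) * nrm a b h.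
Proof.
move=> Lh; rewrite -[leLHS]ger0_norm ?Rintegral_ge0// -sqrtr_sqr -sqrtrM ?subr_ge0//.
apply: ler_wsqrtr; apply: le_trans (Rintegral_norm_sqr ab (Lh j)) _.
rewrite ler_wpM2l ?subr_ge0//.
apply: (@le_trans _ _ (Rintegral mu D (fun s => dotv (h.2 s) (h.2 s)))); last first.
  by rewrite lerDr dotv_ge0.
apply: le_Rintegral => //; [by case: (Lh j)|exact: integrable_dotv|].
by move=> s _; rewrite dotvE (bigD1 j)//= expr2 lerDl sumr_ge0// => i _;
  rewrite -expr2 sqr_ge0.
Qed.

Lemma poly_itv_bounded (p : {poly R}) :
  exists2 M, 0 <= M & forall s, D s -> `|p.[s]| <= M.
Proof.
have [M HM] := poly_itv_bound p a b; exists `|M| => // s /=.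
by rewrite in_itv /= => /HM /le_trans; apply; exact: ler_norm.
Qed.

(** Separates the variables, so that factors depending on [s] can leave an integral over [th]. *)
Lemma horner2E (e : {poly {poly R}}) (s th : R) :
  e.[th%:P].[s] = \sum_(i < size e) (e`_i).[s] * th ^+ i.
Proof.
rewrite (horner_coef e) horner_sum; apply: eq_bigr => i _.
by rewrite hornerM horner_exp hornerC.
Qed.

Lemma poly2_itv_bounded (e : {poly {poly R}}) :
  exists2 M, 0 <= M & forall s th, D s -> D th -> `|e.[th%:P].[s]| <= M.
Proof.
have [M M0 HM] : exists2 M, 0 <= M & forall (i : 'I_(size e)) (u : R * R),
    D u.1 /\ D u.2 -> `|(e`_i).[u.1] * u.2 ^+ i| <= M * 1.
  apply: finite_uniform_bound => // i.
  have [M1 M10 H1] := poly_itv_bounded (e`_i).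
  have [M2 M20 H2] := poly_itv_bounded 'X^i.
  exists (M1 * M2); first exact: mulr_ge0.
  move=> [s th] /= [Ds Dth]; rewrite mulr1 normrM ler_pM ?H1//.
  by have := H2 _ Dth; rewrite hornerXn.
exists (\sum_(i < size e) M); first exact: sumr_ge0.
move=> s th Ds Dth; rewrite horner2E; apply: le_trans (ler_norm_sum _ _ _) _.
by apply: ler_sum => i _; have := HM i (s, th) (conj Ds Dth); rewrite mulr1.
Qed.

Lemma l2_horner (p : {poly R}) (f : R -> R) :
  l2 a b f -> l2 a b (fun s => p.[s] * f s).
Proof.
have [M _ HM] := poly_itv_bounded p.
by apply: (l2_Mbounded _ HM); exact: measurable_poly.
Qed.

Lemma Rintegral_Mbounded (J : set R) (g : R -> R) (M : R) m n (h : H R m n) j :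
  measurable J -> (J `<=` D)%classic -> inL2 a b h ->
  measurable_fun D g -> (forall th, D th -> `|g th| <= M) ->
  `|Rintegral mu J (fun th => g th * h.2 th j 0)| <=
    M * (Num.sqrt (b - a) * nrm a b h).
Proof.
move=> mJ JD Lh mg gM.
have M0 : 0 <= M by apply: le_trans (gM a _) => //=; rewrite in_itv /= lexx.
have Lf := l2_norm (Lh j).
have LM := l2_integrable (l2Z M Lf).
have Lg := l2_Mbounded mg gM (Lh j).
apply: le_trans (le_normr_Rintegral _ _) _ => //.
  by apply: integrableS (l2_integrable Lg).
apply: (@le_trans _ _ (Rintegral mu D (fun th => `|g th * h.2 th j 0|))).
  by apply: le_Rintegral_subset => //; exact: l2_integrable (l2_norm Lg).
apply: (@le_trans _ _ (Rintegral mu D (fun th => M * `|h.2 th j 0|))).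
  apply: le_Rintegral => //; first exact: l2_integrable (l2_norm Lg).
  by move=> th Dth; rewrite normrM ler_wpM2r// gM.
rewrite RintegralZl//; last exact: l2_integrable.
by rewrite ler_wpM2l// Rintegral_norm_le_nrm.
Qed.

Definition bounded_functional m n (psi : H R m n -> R) :=
  exists2 K, 0 <= K & forall h, inL2 a b h -> `|psi h| <= K * nrm a b h.

(** The summand [nrm] absorbs integral and finite-dimensional terms, the summand [eucnorm (h.2 s)]
    the multiplier. Measurability is included so that such a bound yields square integrability by
    domination; the class is closed under finite sums. *)
Definition pointwise_bounded m n (Phi : H R m n -> R -> R) :=
  (forall h, inL2 a b h -> measurable_fun D (Phi h)) /\
  exists2 K, 0 <= K & forall h s, inL2 a b h -> D s ->
    `|Phi h s| <= K * (nrm a b h + eucnorm (h.2 s)).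

Lemma bounded_functionalD m n (psi1 psi2 : H R m n -> R) :
  bounded_functional psi1 -> bounded_functional psi2 ->
  bounded_functional (fun h => psi1 h + psi2 h).
Proof.
move=> [K1 K10 H1] [K2 K20 H2]; exists (K1 + K2); first exact: addr_ge0.
move=> h Lh; apply: le_trans (ler_normD _ _) _.
by rewrite mulrDl lerD ?H1 ?H2.
Qed.

Lemma bounded_functional_sum m n (I : finType) (psi : I -> H R m n -> R) :
  (forall i, bounded_functional (psi i)) ->
  bounded_functional (fun h => \sum_i psi i h).
Proof.
move=> B; elim: (index_enum I) => [|i r IH].
  by exists 0 => // h _; rewrite big_nil normr0 mul0r.
have [K K0 HK] := bounded_functionalD (B i) IH.
by exists K => // h Lh; rewrite big_cons HK.
Qed.

Lemma pointwise_boundedD m n (Phi1 Phi2 : H R m n -> R -> R) :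
  pointwise_bounded Phi1 -> pointwise_bounded Phi2 ->
  pointwise_bounded (fun h s => Phi1 h s + Phi2 h s).
Proof.
move=> [m1 [K1 K10 H1]] [m2 [K2 K20 H2]]; split.
  by move=> h Lh; apply: measurable_funD; [exact: m1|exact: m2].
exists (K1 + K2); first exact: addr_ge0.
move=> h s Lh Ds; apply: le_trans (ler_normD _ _) _.
by rewrite mulrDl lerD ?H1 ?H2.
Qed.

Lemma pointwise_bounded_sum m n (I : finType) (Phi : I -> H R m n -> R -> R) :
  (forall i, pointwise_bounded (Phi i)) ->
  pointwise_bounded (fun h s => \sum_i Phi i h s).
Proof.
move=> B; split=> [h Lh|].
  by apply: measurable_sum => i; have [mB _] := B i; exact: mB.
elim: (index_enum I) => [|i r [K K0 IH]].
  by exists 0 => // h s _ _; rewrite big_nil normr0 mul0r.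
have [_ [L L0 HL]] := B i.
exists (L + K); first exact: addr_ge0.
move=> h s Lh Ds; rewrite big_cons; apply: le_trans (ler_normD _ _) _.
by rewrite mulrDl lerD ?HL ?IH.
Qed.

Lemma pointwise_bounded_horner_fin m n (p : {poly R}) (j : 'I_m) :
  pointwise_bounded (fun (h : H R m n) s => p.[s] * h.1 j 0).
Proof.
split=> [h _|].
  by apply: measurable_funM => //; exact: measurable_poly.
have [M M0 HM] := poly_itv_bounded p; exists M => // h s Lh Ds.
rewrite normrM ler_pM// ?HM//; apply: le_trans (coord_le_nrm h j) _.
by rewrite lerDl sqrtr_ge0.
Qed.

Lemma pointwise_bounded_horner m n (p : {poly R}) (j : 'I_n) :
  pointwise_bounded (fun (h : H R m n) s => p.[s] * h.2 s j 0).
Proof.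
split=> [h Lh|].
  by apply: measurable_funM; [exact: measurable_poly|case: (Lh j)].
have [M M0 HM] := poly_itv_bounded p; exists M => // h s Lh Ds.
rewrite normrM ler_pM// ?HM//; apply: le_trans (norm_le_eucnorm _ _) _.
by rewrite lerDr nrm_ge0.
Qed.

(* [J s] abstracts the two families [[a, s]] and [[s, b]]. *)
Definition integration_domains (J : R -> set R) :=
  [/\ forall s, measurable (J s),
      forall s, D s -> (J s `<=` D)%classic &
      forall g, mu.-integrable D (EFin \o g) ->
        measurable_fun D (fun s => Rintegral mu (J s) g)].

Lemma integration_domains_lower : integration_domains (fun s => `[a, s]%classic).
Proof.
split => //.
  move=> s /=; rewrite in_itv /= => /andP[_ sb] t /=; rewrite !in_itv /=.
  by case/andP => -> /= /le_trans; apply.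
move=> g gD; apply: subspace_continuous_measurable_fun => //.
exact: parameterized_integral_continuous.
Qed.

Lemma integration_domains_upper : integration_domains (fun s => `[s, b]%classic).
Proof.
split => //.
  move=> s /=; rewrite in_itv /= => /andP[sa _] t /=; rewrite !in_itv /=.
  by case/andP => /(le_trans sa) -> ->.
move=> g gD; have [_ _ mlow] := integration_domains_lower.
(* Up to an endpoint, the upper interval is the complement of the lower one, which transfers
   measurability. *)
apply: (@eq_measurable_fun _ _ _ _ _
  (fun s => Rintegral mu D g - Rintegral mu `[a, s]%classic g)).
  move=> s; rewrite inE /= in_itv /= => /andP[sa sb].
  rewrite Rintegral_itvB ?bnd_simp// Rintegral_itv_obnd_cbnd//.
  apply: integrableS gD => // t /=; rewrite !in_itv /=.
  by case/andP => /ltW /(le_trans sa) -> ->.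
by apply: measurable_funB => //; exact: mlow.
Qed.

(** Here [s] occurs both in the domain and in the integrand. Expanding the kernel in powers of [th]
    leaves a finite sum of polynomials in [s] times integrals whose only dependence on [s] is the
    domain, and those are measurable by [integration_domains]. *)
Lemma pointwise_bounded_kernel m n (J : R -> set R) (e : {poly {poly R}}) (j : 'I_n) :
  integration_domains J ->
  pointwise_bounded (fun (h : H R m n) s =>
    Rintegral mu (J s) (fun th => e.[th%:P].[s] * h.2 th j 0)).
Proof.
move=> [mJ JD Jmeas]; split=> [h Lh|].
  have Li i : mu.-integrable D (EFin \o (fun th => th ^+ i * h.2 th j 0)).
    have := l2_integrable (l2_horner 'X^i (Lh j)).
    congr (mu.-integrable D (EFin \o _)); apply/funext => th.
    by rewrite hornerXn.
  apply: (@eq_measurable_fun _ _ _ _ _ (fun s => \sum_(i < size e)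
      (e`_i).[s] * Rintegral mu (J s) (fun th => th ^+ i * h.2 th j 0))).
    move=> s; rewrite inE => Ds; have mJs := mJ s.
    have LJ i : mu.-integrable (J s) (EFin \o (fun th => th ^+ i * h.2 th j 0)).
      by apply: integrableS (Li i); [|exact: mJ|exact: JD].
    transitivity (\sum_(i < size e)
        Rintegral mu (J s) (fun th => (e`_i).[s] * (th ^+ i * h.2 th j 0))).
      by apply: eq_bigr => i _; rewrite RintegralZl; [|exact: mJs|exact: LJ].
    rewrite -Rintegral_sum//; last first.
      by move=> i; apply: (integrableZl _ ((e`_i).[s])) (LJ i).
    apply: eq_Rintegral => th _; rewrite horner2E mulr_suml.
    by apply: eq_bigr => i _; rewrite mulrA.
  apply: measurable_sum => i; apply: measurable_funM.
    exact: measurable_poly.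
  exact: Jmeas.
have [M M0 HM] := poly2_itv_bounded e.
exists (M * Num.sqrt (b - a)); first by rewrite mulr_ge0 ?sqrtr_ge0.
move=> h s Lh Ds; apply: (@le_trans _ _ (M * (Num.sqrt (b - a) * nrm a b h))).
  apply: Rintegral_Mbounded => //; first exact: JD.
    (* For fixed [s] the kernel is an ordinary polynomial in [th]. *)
    suff : measurable_fun D (fun th => (\sum_(i < size e) ((e`_i).[s])%:P * 'X^i).[th]).
      congr (measurable_fun _ _); apply/funext => th.
      rewrite horner2E horner_sum; apply: eq_bigr => i _.
      by rewrite hornerM hornerC hornerXn.
    exact: measurable_poly.
  by move=> th; exact: HM.
by rewrite mulrA ler_wpM2l ?mulr_ge0 ?sqrtr_ge0// lerDl sqrtr_ge0.
Qed.

Lemma PIapply_fst_bounded m1 n1 m2 n2 (O : PIop R m1 n1 m2 n2) i :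
  bounded_functional (fun h => (PIapply a b O h).1 i 0).
Proof.
have E h : inL2 a b h -> (PIapply a b O h).1 i 0 =
    \sum_j PI_P O i j * h.1 j 0 +
    \sum_j Rintegral mu D (fun th => (PI_Q1 O i j).[th] * h.2 th j 0).
  move=> Lh; rewrite !mxE; congr (_ + _); rewrite -Rintegral_sum//.
    apply: eq_Rintegral => th _; rewrite mxE; apply: eq_bigr => j _.
    by rewrite mxE.
  by move=> j; exact: l2_integrable (l2_horner _ (Lh j)).
have [K K0 HK] : bounded_functional (fun h : H R m1 n1 =>
    \sum_j PI_P O i j * h.1 j 0 +
    \sum_j Rintegral mu D (fun th => (PI_Q1 O i j).[th] * h.2 th j 0)).
  apply: bounded_functionalD; apply: bounded_functional_sum => j.
    exists `|PI_P O i j| => // h Lh.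
    by rewrite normrM ler_wpM2l// coord_le_nrm.
  have [M M0 HM] := poly_itv_bounded (PI_Q1 O i j).
  exists (M * Num.sqrt (b - a)); first by rewrite mulr_ge0 ?sqrtr_ge0.
  move=> h Lh; rewrite -mulrA.
  by apply: Rintegral_Mbounded => //; exact: measurable_poly.
by exists K => // h Lh; rewrite E// HK.
Qed.

Lemma pointwise_bounded_vint m n l (J : R -> set R)
    (M : 'M[{poly {poly R}}]_(l, n)) i : integration_domains J ->
  pointwise_bounded (fun (h : H R m n) s =>
    (vint (J s) (fun th => ev2 M s th *m h.2 th)) i 0).
Proof.
move=> HJ; have [mJ JD _] := HJ.
have [mP [K K0 HK]] := pointwise_bounded_sum
  (fun j : 'I_n => @pointwise_bounded_kernel m n J (M i j) j HJ).
have E h s : inL2 a b h -> D s ->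
    (vint (J s) (fun th => ev2 M s th *m h.2 th)) i 0 = \sum_j
    Rintegral mu (J s) (fun th => (M i j).[th%:P].[s] * h.2 th j 0).
  move=> Lh Ds; rewrite mxE -Rintegral_sum//.
    by apply: eq_Rintegral => th _; rewrite mxE; apply: eq_bigr => j _; rewrite mxE.
  move=> j.
  suff : mu.-integrable D (EFin \o (fun th => (M i j).[th%:P].[s] * h.2 th j 0)).
    by apply: integrableS; [|exact: mJ|exact: JD].
  have := l2_integrable (l2_horner
    (\sum_(k < size (M i j)) ((M i j)`_k).[s]%:P * 'X^k) (Lh j)).
  congr (mu.-integrable D (EFin \o _)); apply/funext => th.
  rewrite horner2E horner_sum; congr (_ * _); apply: eq_bigr => k _.
  by rewrite hornerM hornerC hornerXn.
split=> [h Lh|].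
  apply: eq_measurable_fun (mP h Lh) => s; rewrite inE => Ds.
  by rewrite E.
by exists K => // h s Lh Ds; rewrite E// HK.
Qed.

Lemma PIapply_snd_bounded m1 n1 m2 n2 (O : PIop R m1 n1 m2 n2) i :
  pointwise_bounded (fun h s => (PIapply a b O h).2 s i 0).
Proof.
have -> : (fun (h : H R m1 n1) s => (PIapply a b O h).2 s i 0) = fun h s =>
    \sum_j (PI_Q2 O i j).[s] * h.1 j 0 + \sum_j (PI_R0 O i j).[s] * h.2 s j 0
    + (vint `[a, s] (fun th => ev2 (PI_R1 O) s th *m h.2 th)) i 0
    + (vint `[s, b] (fun th => ev2 (PI_R2 O) s th *m h.2 th)) i 0.
  apply/funext => h; apply/funext => s; rewrite !mxE.
  by do 3 congr (_ + _); apply: eq_bigr => j _; rewrite mxE.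
apply: pointwise_boundedD; [apply: pointwise_boundedD;
  [apply: pointwise_boundedD; apply: pointwise_bounded_sum => j|]|].
- exact: pointwise_bounded_horner_fin.
- exact: pointwise_bounded_horner.
- exact: (@pointwise_bounded_vint _ _ _ _ _ _ integration_domains_lower).
- exact: (@pointwise_bounded_vint _ _ _ _ _ _ integration_domains_upper).
Qed.

Lemma l2_eucnorm m n (h : H R m n) : inL2 a b h -> l2 a b (fun s => eucnorm (h.2 s)).
Proof.
move=> Lh; have i1 := integrable_dotv Lh Lh.
split; last first.
  move: i1; congr (mu.-integrable D _); apply/funext => s /=.
  by rewrite eucnorm_sqr.
apply: (@measurableT_comp _ _ _ _ _ _ (@Num.sqrt R)).
  exact: continuous_measurable_fun (@sqrt_continuous R).
by apply/measurable_EFinP; case/integrableP: i1.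
Qed.

(** The majorant [K (|h| + |h(s)|)] is itself square integrable, constants being so on a bounded
    interval. *)
Lemma PIapply_inL2 m1 n1 m2 n2 (O : PIop R m1 n1 m2 n2) h :
  inL2 a b h -> inL2 a b (PIapply a b O h).
Proof.
move=> Lh i; have [mP [K K0 HK]] := PIapply_snd_bounded O i.
apply: (l2_le (mP h Lh) (l2Z K (l2D (l2_cst (nrm a b h)) (l2_eucnorm Lh)))).
by move=> s Ds; apply: le_trans (HK h s Lh Ds) _; exact: ler_norm.
Qed.

Lemma PIapply_bounded m1 n1 m2 n2 (O : PIop R m1 n1 m2 n2) :
  exists2 K, 0 <= K & forall h, inL2 a b h ->
    nrm a b (PIapply a b O h) <= K * nrm a b h.
Proof.
have [K1 K10 H1] : exists2 K, 0 <= K & forall i h, inL2 a b h ->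
    `|(PIapply a b O h).1 i 0| <= K * nrm a b h.
  apply: finite_uniform_bound => [h _|i]; first exact: nrm_ge0.
  exact: PIapply_fst_bounded.
have [K2 K20 H2] : exists2 K, 0 <= K & forall i (u : H R m1 n1 * R),
    inL2 a b u.1 /\ D u.2 ->
    `|(PIapply a b O u.1).2 u.2 i 0| <= K * (nrm a b u.1 + eucnorm (u.1.2 u.2)).
  apply: finite_uniform_bound => [u _|i]; first by rewrite addr_ge0 ?sqrtr_ge0.
  have [_ [K K0 HK]] := PIapply_snd_bounded O i.
  by exists K => // -[h s] [] /=; exact: HK.
(* Each finite coordinate contributes [K1^2 N^2]. Each function coordinate is at most
   [2 K2^2 (N^2 + |h(s)|^2)] after squaring; integration turns the bracket into at most
   [(b - a) N^2 + N^2]. *)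
pose C := m2%:R * K1 ^+ 2 + n2%:R * (2 * K2 ^+ 2 * (b - a + 1)).
have C0 : 0 <= C.
  by rewrite /C addr_ge0// ?mulr_ge0 ?sqr_ge0 ?ler0n// addr_ge0 ?subr_ge0.
exists (Num.sqrt C); first exact: sqrtr_ge0.
move=> h Lh; set N := nrm a b h; have N0 : 0 <= N := nrm_ge0 h.
apply: nrm_le; first by rewrite mulr_ge0 ?sqrtr_ge0.
rewrite exprMn sqr_sqrtr// /C mulrDl /ip; apply: lerD.
  rewrite dotvE -[X in X%:R]card_ord -sumr_const mulr_suml mulr_suml.
  apply: ler_sum => i _; rewrite mul1r -expr2 -exprMn -real_normK ?num_real//.
  by rewrite ler_pXn2r ?nnegrE ?mulr_ge0// H1.
have LO := PIapply_inL2 O Lh.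
have Ln := integrable_dotv Lh Lh.
pose w s := n2%:R * (2 * K2 ^+ 2 * N ^+ 2) + n2%:R * (2 * K2 ^+ 2) * dotv (h.2 s) (h.2 s).
have i1 : mu.-integrable D (EFin \o
    (fun s => n2%:R * (2 * K2 ^+ 2) * dotv (h.2 s) (h.2 s))).
  by apply: (integrableZl _ (n2%:R * (2 * K2 ^+ 2))) Ln.
apply: (@le_trans _ _ (Rintegral mu D w)).
  apply: le_Rintegral => //; first exact: integrable_dotv.
    by apply: integrableD (integrable_cst_itv (n2%:R * (2 * K2 ^+ 2 * N ^+ 2))) i1.
  move=> s Ds; rewrite [leRHS](_ : _ = n2%:R *
    (2 * K2 ^+ 2 * (N ^+ 2 + dotv (h.2 s) (h.2 s)))); last by rewrite /w; ring.
  rewrite [leLHS]dotvE -[X in X%:R]card_ord -sumr_const mulr_suml.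
  apply: ler_sum => i _; rewrite mul1r -expr2.
  rewrite -real_normK ?num_real// -eucnorm_sqr.
  apply: (@le_trans _ _ ((K2 * (N + eucnorm (h.2 s))) ^+ 2)).
    rewrite ler_pXn2r ?nnegrE ?mulr_ge0 ?addr_ge0 ?sqrtr_ge0//.
    exact: (H2 i (h, s)).
  rewrite exprMn; have := sqr_ge0 (N - eucnorm (h.2 s)); have := sqr_ge0 K2.
  by nra.
rewrite RintegralD//; last exact: integrable_cst_itv.
rewrite Rintegral_cst_itv// RintegralZl//.
have -> : n2%:R * (2 * K2 ^+ 2 * (b - a + 1)) * N ^+ 2 =
  n2%:R * (2 * K2 ^+ 2 * N ^+ 2) * (b - a) + n2%:R * (2 * K2 ^+ 2) * N ^+ 2 by ring.
rewrite lerD2l ler_wpM2l ?mulr_ge0 ?ler0n ?sqr_ge0//.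
by rewrite nrm_sqr lerDr dotv_ge0.
Qed.

End PIOperators.

(** * Energy decay, the primal-dual pairing, and the output bounds *)

Section Evolution.
Set Implicit Arguments.
Unset Strict Implicit.
Context {R : realType} {a b : R}.

Lemma hsubK k l (h g : H R k l) : hadd (hsub h g) g = h.
Proof.
rewrite [RHS]surjective_pairing; apply/pair_equal_spec.
split; first by rewrite /= scaleN1r addrNK.
by apply/funext => s; rewrite /= scaleN1r addrNK.
Qed.

Lemma is_adjoint_sym k1 l1 k2 l2 (F : H R k1 l1 -> H R k2 l2) G :
  (forall h, inL2 a b h -> inL2 a b (F h)) ->
  is_adjoint a b F G -> is_adjoint a b G F.
Proof.
by move=> LF [LG FG]; split => // h g Lh Lg; rewrite ipC -FG// ipC.
Qed.

(** Taking [e = 1] keeps the difference quotients within 1 of [y'], whence the constant. This makes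
    quadratic remainders of order [h^2]. *)
Lemma has_deriv_at_lipschitz k l (y : R -> H R k l) (y' : H R k l) (t : R) :
  (forall s, 0 <= s -> inL2 a b (y s)) -> inL2 a b y' -> 0 <= t ->
  has_deriv_at a b y y' t ->
  exists2 d, 0 < d & forall h, h != 0 -> `|h| < d -> 0 <= t + h ->
    nrm a b (hsub (y (t + h)) (y t)) <= (nrm a b y' + 1) * `|h|.
Proof.
move=> Ly Ly' t0 /(_ 1 ltr01)[d d0 Hd]; exists d => // h h0 hd th.
have Ld : inL2 a b (hsub (y (t + h)) (y t)) by apply: inL2_hsub; exact: Ly.
have Lq := inL2_hscale h^-1 Ld.
have := nrm_hadd (inL2_hsub Lq Ly') Ly'.
rewrite hsubK nrm_hscale// normfV ler_pdivrMl ?normr_gt0// => /le_trans; apply.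
by rewrite mulrC ler_wpM2r// addrC lerD2l Hd.
Qed.

(** Boundedness of [Q] enters through the remainder [<d, Q d>], at most [K |d|^2], which still
    vanishes after division by the increment. The lemma is applied with [y = T x] and [y' = A x]. *)
Lemma energy_nonincreasing k l (Q : H R k l -> H R k l) (K : R) (y y' : R -> H R k l) :
  psd a b Q -> (forall h, inL2 a b h -> inL2 a b (Q h)) -> 0 <= K ->
  (forall h, inL2 a b h -> nrm a b (Q h) <= K * nrm a b h) ->
  (forall t, 0 <= t -> inL2 a b (y t)) -> (forall t, 0 <= t -> inL2 a b (y' t)) ->
  (forall t, 0 <= t -> has_deriv_at a b y (y' t) t) ->
  (forall t, 0 <= t -> ip a b (y' t) (Q (y t)) <= 0) ->
  forall t, 0 <= t -> ip a b (y t) (Q (y t)) <= ip a b (y 0) (Q (y 0)).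
Proof.
move=> [Qsym _] LQ K0 QK Ly Ly' Dy Hy t t0.
apply: (nonincreasing_of_quotients (f := fun s => ip a b (y s) (Q (y s)))) => //.
move=> s /andP[s0 _] e e0.
have [Ls Ls'] := (Ly _ s0, Ly' _ s0).
pose N := nrm a b (y' s) + 1.
(* The outer summands are the factors of [e1] in twice [C1] and in [C2]; the 1 makes [L]
   positive. *)
pose L := 2 * nrm a b (Q (y s)) + 1 + K * N ^+ 2.
have N0 : 0 < N by rewrite ltr_wpDl ?nrm_ge0.
have L0 : 0 < L.
  have q0 := nrm_ge0 (a := a) (b := b) (Q (y s)).
  by have := mulr_ge0 K0 (sqr_ge0 N); rewrite /L; lra.
pose e1 := e / L; have e10 : 0 < e1 by rewrite divr_gt0.
have [d1 d10 H1] := Dy s s0 e1 e10.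
have [d2 d20 H2] := has_deriv_at_lipschitz Ly Ls' s0 (Dy s s0).
exists (Num.min (Num.min d1 d2) e1); first by rewrite !lt_min d10 d20 e10.
move=> h h0; rewrite !lt_min => /andP[/andP[hd1 hd2] he1] /andP[sh0 _].
have Lsh := Ly _ sh0.
set u := y (s + h); set v := y s.
have Lu : inL2 a b u by [].
have Lv : inL2 a b v by [].
have LQu := LQ _ Lu; have LQv := LQ _ Lv.
have Ld := inL2_hsub Lu Lv; set dl := hsub u v.
have LQd := LQ _ Ld.
have Lq := inL2_hscale h^-1 Ld.
(* [V(s+h) - V(s) = 2 <d, Q v> + <d, Q d>] with [v = y(s)] and [d = y(s+h) - y(s)]. *)
have E : ip a b u (Q u) - ip a b v (Q v) = 2 * ip a b dl (Q v) + ip a b dl (Q dl).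
  have -> : ip a b dl (Q dl) = ip a b dl (Q u) - ip a b dl (Q v).
    by rewrite -(Qsym _ _ Ld Ld) ipBr// !Qsym.
  rewrite !ipBl// -(Qsym v u)// (ipC (Q v)).
  by ring.
rewrite E mulrDr mulrCA.
have -> : h^-1 * ip a b dl (Q v) =
    ip a b (hsub (hscale h^-1 dl) (y' s)) (Q v) + ip a b (y' s) (Q v).
  by rewrite ipBl// ipZl// subrK.
have C1 := cauchy_schwarz (inL2_hsub Lq Ls') LQv.
have {}C1 : ip a b (hsub (hscale h^-1 dl) (y' s)) (Q v) <= e1 * nrm a b (Q v).
  apply: le_trans (ler_norm _) _; apply: le_trans C1 _.
  by rewrite ler_wpM2r ?nrm_ge0// H1.
have C2 : h^-1 * ip a b dl (Q dl) <= K * N ^+ 2 * e1.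
  apply: le_trans (ler_norm _) _; rewrite normrM normfV ler_pdivrMl ?normr_gt0//.
  apply: le_trans (cauchy_schwarz Ld LQd) _.
  have nd : nrm a b dl <= N * `|h| by exact: H2.
  apply: (@le_trans _ _ (K * (N * `|h|) ^+ 2)).
    apply: (@le_trans _ _ (K * nrm a b dl ^+ 2)).
      by rewrite expr2 mulrCA ler_wpM2l ?nrm_ge0// QK.
    by rewrite ler_wpM2l// ler_pXn2r ?nnegrE ?nrm_ge0// mulr_ge0// ltW.
  rewrite exprMn (_ : K * (N ^+ 2 * `|h| ^+ 2) = `|h| * (K * N ^+ 2 * `|h|)); last by ring.
  by rewrite ler_wpM2l// ler_wpM2l ?mulr_ge0 ?sqr_ge0// ltW.
have := Hy s s0; rewrite -/v => Hv.
have -> : e = L * e1 by rewrite /e1 mulrC divfK// gt_eqF.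
by rewrite /L; have := nrm_ge0 (a := a) (b := b) (Q v); nra.
Qed.

(** One half of the conservation law suffices, because the left side becomes the squared output norm
    and the right side the quantity to be estimated. The derivative [y'] of [y] itself keeps
    [y (s + h)] near [y s]. *)
Lemma pairing_le m n (T A Ts As : H R m n -> H R m n) (x y y' : R -> H R m n) :
  (forall h, inL2 a b h -> inL2 a b (T h)) ->
  (forall h, inL2 a b h -> inL2 a b (A h)) ->
  is_adjoint a b T Ts -> is_adjoint a b A As ->
  (forall t, 0 <= t -> inL2 a b (x t)) ->
  (forall t, 0 <= t -> has_deriv_at a b (fun s => T (x s)) (A (x t)) t) ->
  (forall t, 0 <= t -> inL2 a b (y t)) ->
  (forall t, 0 <= t -> has_deriv_at a b (fun s => Ts (y s)) (As (y t)) t) ->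
  (forall t, 0 <= t -> inL2 a b (y' t)) ->
  (forall t, 0 <= t -> has_deriv_at a b y (y' t) t) ->
  forall t, 0 <= t -> ip a b (T (x t)) (y 0) <= ip a b (T (x 0)) (y t).
Proof.
move=> LT LA [LTs TTs] [LAs AAs] Lx Dx Ly Dy Ly' Dy' t t0.
have := @nonincreasing_of_quotients R (fun s => - ip a b (T (x (t - s))) (y s)) t t0.
rewrite subrr subr0 lerN2; apply.
move=> s /andP[s0 st] e e0.
have ts0 : 0 <= t - s by lra.
have [[Lxs Lys] Lys'] := (Lx _ ts0, Ly _ s0, Ly' _ s0).
have [LAx LTx] := (LA _ Lxs, LT _ Lxs).
have [LAy LTy] := (LAs _ Lys, LTs _ Lys).
pose X := nrm a b (x (t - s)); pose Z := nrm a b (A (x (t - s))).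
pose Y := nrm a b (y s); pose N := nrm a b (y' s) + 1.
have [X0 Z0 Y0 N'0] : [/\ 0 <= X, 0 <= Z, 0 <= Y & 0 <= nrm a b (y' s)].
  by split; exact: nrm_ge0.
have N0 : 0 < N by rewrite ltr_wpDl.
(* [Y + N] bounds the norm of [y (s + h)] for increments of size at most 1; [Z * N] and [X] are the
   factors of [e1] in [C2] and [C3]. *)
pose L := Y + N + Z * N + X + 1.
have L0 : 0 < L by rewrite ltr_wpDl// !addr_ge0 ?mulr_ge0// ltW.
pose e1 := e / L; have e10 : 0 < e1 by rewrite divr_gt0.
have [d1 d10 H1] := Dx _ ts0 e1 e10.
have [d2 d20 H2] := Dy _ s0 e1 e10.
have [d3 d30 H3] := has_deriv_at_lipschitz Ly Lys' s0 (Dy' s s0).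
exists (Num.min (Num.min d1 d2) (Num.min d3 (Num.min e1 1))).
  by rewrite !lt_min d10 d20 d30 e10 ltr01.
move=> h h0; rewrite !lt_min => /andP[/andP[hd1 hd2] /and3P[hd3 he1 h1]] /andP[sh0 sht].
have tsh0 : 0 <= t - s + - h by lra.
(* The primal trajectory runs backwards: advancing [s] by [h] moves its time [t - s] by [- h]. *)
have := H1 (- h); rewrite oppr_eq0 normrN => /(_ h0 hd1 tsh0) {}H1.
have {}H2 := H2 h h0 hd2 sh0.
have {}H3 := H3 h h0 hd3 sh0.
have -> : t - (s + h) = t - s + - h by ring.
have Lxh := Lx _ tsh0; have Lyh := Ly _ sh0.
have LTxh := LT _ Lxh; have LTyh := LTs _ Lyh.
have Ldx := inL2_hsub LTxh LTx; have Ldy := inL2_hsub LTyh LTy.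
have Lqx := inL2_hscale (- h)^-1 Ldx; have Lqy := inL2_hscale h^-1 Ldy.
have Ldyy := inL2_hsub Lyh Lys.
set x0 := x (t - s) in Lxs LAx LTx Ldx Lqx H1 *.
set x1 := x (t - s + - h) in Lxh LTxh Ldx Lqx H1 *.
set y0 := y s in Lys LAy LTy Ldy Lqy Ldyy H2 H3 *.
set y1 := y (s + h) in Lyh LTyh Ldy Lqy Ldyy H2 H3 *.
(* In the last term [T] has been moved onto the difference of [y]. The limits [<A x0, y0>] and
   [<x0, As y0>] cancel by adjointness, so only errors remain. *)
have -> : h^-1 * (- ip a b (T x1) y1 - - ip a b (T x0) y0) =
   ip a b (hsub (hscale (- h)^-1 (hsub (T x1) (T x0))) (A x0)) y1
   + ip a b (A x0) (hsub y1 y0)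
   - ip a b x0 (hsub (hscale h^-1 (hsub (Ts y1) (Ts y0))) (As y0)).
  rewrite !ipBl// !ipBr// ipZl// ipZr// ipBl// ipBr//.
  rewrite -!AAs// -!TTs// invrN; ring.
have C1 := cauchy_schwarz (inL2_hsub Lqx LAx) Lyh.
have C2 := cauchy_schwarz LAx Ldyy.
have C3 := cauchy_schwarz Lxs (inL2_hsub Lqy LAy).
have ny1 : nrm a b y1 <= Y + N.
  have := nrm_hadd Ldyy Lys.
  rewrite hsubK => /le_trans; apply; rewrite addrC lerD2l; apply: le_trans H3 _.
  by rewrite ler_piMr// ltW.
have {}C1 : ip a b (hsub (hscale (- h)^-1 (hsub (T x1) (T x0))) (A x0)) y1 <= e1 * (Y + N).
  apply: le_trans (ler_norm _) _; apply: le_trans C1 _.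
  by rewrite ler_pM ?nrm_ge0.
have {}C2 : ip a b (A x0) (hsub y1 y0) <= Z * (N * e1).
  apply: le_trans (ler_norm _) _; apply: le_trans C2 _.
  rewrite ler_wpM2l//; apply: le_trans H3 _.
  by rewrite ler_wpM2l// ltW.
have {}C3 : - ip a b x0 (hsub (hscale h^-1 (hsub (Ts y1) (Ts y0))) (As y0)) <= X * e1.
  apply: le_trans (ler_norm _) _; rewrite normrN; apply: le_trans C3 _.
  by rewrite ler_wpM2l.
have -> : e = L * e1 by rewrite /e1 mulrC divfK// gt_eqF.
by rewrite /L; lra.
Qed.

Lemma lyapunov_bound m n k p (T A Ts As : H R m n -> H R m n)
    (B : H R k 0 -> H R m n) (Bs : H R m n -> H R k 0)
    (C : H R m n -> H R p 0) (Cs : H R p 0 -> H R m n)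
    (Q : H R m n -> H R m n) (K gamma : R) (v : 'cV[R]_k) (x : R -> H R m n) :
  (forall h, inL2 a b h -> inL2 a b (T h)) ->
  (forall h, inL2 a b h -> inL2 a b (A h)) ->
  (forall h, inL2 a b h -> inL2 a b (B h)) ->
  is_adjoint a b T Ts -> is_adjoint a b A As ->
  is_adjoint a b B Bs -> is_adjoint a b C Cs ->
  psd a b Q -> (forall h, inL2 a b h -> inL2 a b (Q h)) -> 0 <= K ->
  (forall h, inL2 a b h -> nrm a b (Q h) <= K * nrm a b h) ->
  0 < gamma ->
  ople a b (fun h => Bs (Q (B h))) id ->
  ople a b (fun h => hadd (As (Q (T h))) (Ts (Q (A h)))) (fun _ => hzero R m n) ->
  ople a b (fun h => hscale (gamma ^- 2) (Cs (C h))) (fun h => Ts (Q (T h))) ->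
  is_solution a b T A B v x ->
  forall t, 0 <= t -> eucnorm (C (x t)).1 <= gamma * eucnorm v.
Proof.
move=> LT LA LB [LTs TTs] [LAs AAs] [LBs BBs] [LCs CCs] Qpsd LQ K0 QK g0.
move=> [_ ineqB] [_ ineqT] [_ ineqC] [Lx [_ [Dx x00]]] t t0.
have Qsym := Qpsd.1.
have Lv : inL2 a b (vecH v) by exact: inL2_fin.
have Lt := Lx t t0; have L0 := Lx 0 (lexx 0).
have LC h : inL2 a b (C h) by exact: inL2_fin.
have V0 : ip a b (T (x 0)) (Q (T (x 0))) <= eucnorm v ^+ 2.
  have [LT0 LBv] := (LT _ L0, LB _ Lv).
  rewrite (ip_nrm_hsub0 LT0 LBv (LQ _ LT0) x00) -Qsym// ipC.
  rewrite (ip_nrm_hsub0 LT0 LBv (LQ _ LBv) x00).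
  have := ineqB _ Lv; rewrite ipBr//; last exact: inL2_fin.
  rewrite -BBs//; [|exact: LQ].
  by rewrite subr_ge0 ip_fin eucnorm_sqr.
have Vt : ip a b (T (x t)) (Q (T (x t))) <= ip a b (T (x 0)) (Q (T (x 0))).
  apply: (energy_nonincreasing (y := fun s => T (x s)) (y' := fun s => A (x s))
    Qpsd LQ K0 QK) => // s s0; [exact: LT (Lx s s0)|exact: LA (Lx s s0)|].
  have Ls := Lx s s0; have [LTs' LAs'] := (LT _ Ls, LA _ Ls).
  have [LQT LQA] := (LQ _ LTs', LQ _ LAs').
  have Lz : inL2 a b (hzero R m n).
    move=> i; have := l2_cst (a := a) (b := b) 0.
    by rewrite (_ : (fun=> 0) = fun s => (hzero R m n).2 s i 0)//;
      apply/funext => r; rewrite mxE.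
  have := ineqT _ Ls; rewrite ipBr//; last by apply: inL2_hadd; [exact: LAs|exact: LTs].
  rewrite ipDr//; [|exact: LAs|exact: LTs].
  (* By symmetry of [Q] both summands of the condition equal [<A x, Q T x>], which is therefore
     nonpositive. *)
  rewrite -AAs// -TTs// -Qsym// (ipC (Q _)).
  have -> : ip a b (x s) (hzero R m n) = 0.
    have -> : hzero R m n = hscale 0 (x s).
      rewrite /hzero /hscale scale0r; congr pair.
      by apply/funext => r; rewrite scale0r.
    by rewrite ipZr// mul0r.
  by lra.
have := ineqC _ Lt.
have [LTt LCt] := (LT _ Lt, LCs _ (LC (x t))).
rewrite ipBr// ?ipZr//; [|exact/LTs/LQ|exact: inL2_hscale].
rewrite -TTs//; last exact: LQ.
rewrite -CCs// ip_fin -eucnorm_sqr subr_ge0 => H.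
have {}H := le_trans H (le_trans Vt V0).
rewrite -ler_sqr ?nnegrE ?mulr_ge0 ?sqrtr_ge0 ?(ltW g0)//.
by rewrite exprMn -ler_pdivrMl ?exprn_gt0.
Qed.

Lemma dual_lyapunov_bound m n k p (T A Ts As : H R m n -> H R m n)
    (B : H R k 0 -> H R m n) (Bs : H R m n -> H R k 0)
    (C : H R m n -> H R p 0) (Cs : H R p 0 -> H R m n)
    (Q : H R m n -> H R m n) (K gamma : R) (v : 'cV[R]_k) (x : R -> H R m n) :
  (forall h, inL2 a b h -> inL2 a b (T h)) ->
  (forall h, inL2 a b h -> inL2 a b (A h)) ->
  (forall h, inL2 a b h -> inL2 a b (B h)) ->
  is_adjoint a b T Ts -> is_adjoint a b A As ->
  is_adjoint a b B Bs -> is_adjoint a b C Cs ->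
  well_posed a b Ts As Cs ->
  psd a b Q -> (forall h, inL2 a b h -> inL2 a b (Q h)) -> 0 <= K ->
  (forall h, inL2 a b h -> nrm a b (Q h) <= K * nrm a b h) ->
  0 < gamma ->
  ople a b (fun h => C (Q (Cs h))) id ->
  ople a b (fun h => hadd (A (Q (Ts h))) (T (Q (As h)))) (fun _ => hzero R m n) ->
  ople a b (fun h => hscale (gamma ^- 2) (B (Bs h))) (fun h => T (Q (Ts h))) ->
  is_solution a b T A B v x ->
  forall t, 0 <= t -> eucnorm (C (x t)).1 <= gamma * eucnorm v.
Proof.
move=> LT LA LB TTs AAs BBs CCs wp Qpsd LQ K0 QK g0 iC iT iB [Lx [_ [Dx x00]]] t t0.
have LC h : inL2 a b h -> inL2 a b (C h) by move=> _; exact: inL2_fin.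
(* The dual PIE is started from the output [C (x t)] itself. *)
pose z := (C (x t)).1.
have [[y soly] _] := wp z.
have yb : eucnorm (Bs (y t)).1 <= gamma * eucnorm z.
  exact: (lyapunov_bound TTs.1 AAs.1 CCs.1 (is_adjoint_sym LT TTs)
    (is_adjoint_sym LA AAs) (is_adjoint_sym LC CCs) (is_adjoint_sym LB BBs)
    Qpsd LQ K0 QK g0 iC iT iB soly).
have [Ly [[y' [Ly' [Dy' _]]] [Dy y00]]] := soly.
have Lz : inL2 a b (vecH z) by exact: inL2_fin.
have Lv : inL2 a b (vecH v) by exact: inL2_fin.
have [[[Lxt Lx0] Lyt] Ly0] := (Lx t t0, Lx 0 (lexx 0), Ly t t0, Ly 0 (lexx 0)).
have P : eucnorm z ^+ 2 <= ip a b (vecH v) (Bs (y t)).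
  have -> : eucnorm z ^+ 2 = ip a b (T (x t)) (y 0).
    have -> : eucnorm z ^+ 2 = ip a b (C (x t)) (vecH z) by rewrite ip_fin eucnorm_sqr.
    rewrite CCs.2// TTs.2// !(ipC (x t)).
    by rewrite (ip_nrm_hsub0 (TTs.1 _ Ly0) (CCs.1 _ Lz) Lxt y00).
  rewrite -BBs.2// -(ip_nrm_hsub0 (LT _ Lx0) (LB _ Lv) Lyt x00).
  exact: (pairing_le LT LA TTs AAs Lx Dx Ly Dy Ly' Dy' t0).
(* With [yb] this gives [|z|^2 <= gamma |v| |z|]; one factor [|z|] is cancelled once the case
   [z = 0] is set apart. *)
have := cauchy_schwarz Lv (BBs.1 _ Lyt); rewrite !nrm_fin => CS.
have {}P := le_trans P (le_trans (ler_norm _) CS).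
have [z0 v0] : 0 <= eucnorm z /\ 0 <= eucnorm v by rewrite !sqrtr_ge0.
rewrite -/z; have [->|zn0] := eqVneq (eucnorm z) 0; first by rewrite mulr_ge0// ltW.
have zgt0 : 0 < eucnorm z by rewrite lt_neqAle eq_sym zn0.
rewrite -(ler_pM2r zgt0) -expr2; apply: le_trans P _.
by rewrite mulrAC [leRHS]mulrC ler_wpM2l.
Qed.

End Evolution.

Theorem theorem2 (R : realType) (a b : R) (m n nw nz : nat)
  (T A : PIop R m n m n) (B : PIop R nw 0 m n) (C : PIop R m n nz 0)
  (Ts As : H R m n -> H R m n) (Bs : H R m n -> H R nw 0) (Cs : H R nz 0 -> H R m n)
  (hab : a < b)
  (hTs : is_adjoint a b (PIapply a b T) Ts)
  (hAs : is_adjoint a b (PIapply a b A) As)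
  (hBs : is_adjoint a b (PIapply a b B) Bs)
  (hCs : is_adjoint a b (PIapply a b C) Cs)
  (hwp : well_posed a b (PIapply a b T) (PIapply a b A) (PIapply a b B))
  (hwpd : well_posed a b Ts As Cs)
  (gamma : R) (hgamma : 0 < gamma) (Q : PIop R m n m n)
  (hQ : psd a b (PIapply a b Q)) :
  let T' := PIapply a b T in let A' := PIapply a b A in
  let B' := PIapply a b B in let C' := PIapply a b C in
  let Q' := PIapply a b Q in
  ((ople a b (fun h => Bs (Q' (B' h))) id /\
    ople a b (fun h => hadd (As (Q' (T' h))) (Ts (Q' (A' h)))) (fun _ => hzero R m n) /\
    ople a b (fun h => hscale (gamma ^- 2) (Cs (C' h))) (fun h => Ts (Q' (T' h))))
   \/
   (ople a b (fun h => C' (Q' (Cs h))) id /\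
    ople a b (fun h => hadd (A' (Q' (Ts h))) (T' (Q' (As h)))) (fun _ => hzero R m n) /\
    ople a b (fun h => hscale (gamma ^- 2) (B' (Bs h))) (fun h => T' (Q' (Ts h))))) ->
  (ip_norm a b T' A' B' C' <= gamma%:E)%E.
Proof.
move=> T' A' B' C' Q' LMI.
have ab := ltW hab.
have L m1 n1 m2 n2 (O : PIop R m1 n1 m2 n2) h : inL2 a b h -> inL2 a b (PIapply a b O h).
  exact: PIapply_inL2.
have [K K0 HK] := PIapply_bounded ab Q.
apply: ge_ereal_sup => _ [x [v [v1 sol]]] [t /= t0 <-].
rewrite lee_fin -[gamma]mulr1 -v1.
case: LMI => -[h1 [h2 h3]].
- exact: (lyapunov_bound (L _ _ _ _ T) (L _ _ _ _ A) (L _ _ _ _ B) hTs hAs hBs hCs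
    hQ (L _ _ _ _ Q) K0 HK hgamma h1 h2 h3 sol).
- exact: (dual_lyapunov_bound (L _ _ _ _ T) (L _ _ _ _ A) (L _ _ _ _ B) hTs hAs hBs hCs
    hwpd hQ (L _ _ _ _ Q) K0 HK hgamma h1 h2 h3 sol).
Qed.
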